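(* Let $n$ be a positive integer. Define a double-indexed sequence $U_r(k)$ (integers $r\ge 0$, $k\ge 0$) by $U_r(0)=1$ for all $r$ and, for $k\ge 1$, $$U_r(k)=(n-r-k)\,U_r(k-1)-2\,(n-2r-\delta(n-1))\,U_{r+1}(k-1).$$ Then $$\frac{U_0(\lfloor n/2\rfloor)}{(n-1)(n-2)\cdots(n-\lfloor n/2\rfloor)}=\begin{cases}+2 & n\equiv 0 \pmod 6\\ +1 & n\equiv\pm1\pmod 6\\ -1 & n\equiv\pm2\pmod 6\\ -2 & n\equiv \pm 3\pmod 6.\end{cases}$$
   Context: For an integer $m\ge 0$, $\delta(m)\in\{0,1\}$ is the residue of $m$ modulo $2$. The denominator is $\prod_{j=1}^{\lfloor n/2\rfloor}(n-j)$; an empty product equals $1$. *)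

(* Defs.v *)
From HB Require Import structures.
From mathcomp Require Import all_boot all_order all_algebra.
Set Implicit Arguments.
Unset Strict Implicit.
Unset Printing Implicit Defensive.
Import Order.TTheory GRing.Theory Num.Theory.
Local Open Scope ring_scope.

Definition delta (m : nat) : nat := (m %% 2)%N.

(* [U n r k] is U_r(k). It is integer-valued because the factors n - r - k and
   n - 2r - delta(n - 1) may be negative. The truncated subtraction (n - 1)%N
   is the usual one for n > 0. *)
Fixpoint U (n r k : nat) {struct k} : int :=
  if k is k'.+1 then
    (n%:Z - r%:Z - k%:Z) * U n r k'
    - 2 * (n%:Z - 2 * r%:Z - (delta (n - 1)%N)%:Z) * U n r.+1 k'
  else 1.

(* Main.v *)
Require Import Defs.
From HB Require Import structures.
From mathcomp Require Import all_boot all_order all_algebra.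
From mathcomp Require Import zify ring.
Set Implicit Arguments.
Unset Strict Implicit.
Unset Printing Implicit Defensive.
Import Order.TTheory GRing.Theory Num.Theory.
Local Open Scope ring_scope.

(** Unfold the recurrence for [U n r k] into a sum over lattice paths: each of
the [k] steps either stays at [r] or jumps to [r + 1]. Along any path a stay
lowers [r + k] by one and a jump preserves it, so the weights met at the stays
are always n - r - k, n - r - k + 1, ... in this order, and the weights met at
the jumps are always those of r, r + 1, ... . Hence the weight of a path depends
only on its number j of jumps, and [U n r k] is a single binomial sum
([U_sum_paths]).

Now take r = 0 and k = m, where m = n./2. Up to sign, the product of the first j
jump weights is 2 ^ j times a product of consecutive odd numbers, which
interleaved with the factors of 2 ^ j * m ^_ j gives n ^_ (2 j)
([ffact_double]). After division by (n-1) ^_ m, the j-th term becomes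
(-1)^j n/(n-j) 'C(n-j, j) ([U_diag]), so the quotient is the Lucas polynomial
value sum_j (-1)^j n/(n-j) 'C(n-j, j), known to be 2 cos (n pi / 3).

The last evaluation is done without trigonometry. The splitting
n/(n-j) 'C(n-j, j) = 'C(n-j, j) + 'C(n-j-1, j-1) turns the sum, for
n > 1, into F n - F (n-2), where F n = sum_j (-1)^j 'C(n-j, j) ([lucas_sum]). Pascal's rule gives
F (n+2) = F (n+1) - F n, so F (n+3) = - F n: F has period 6, and the six cases
follow from F 0 = F 1 = 1. *)

Lemma sum_bin_pascal (V : zmodType) (f : nat -> V) (k : nat) :
  \sum_(j < k.+2) f j *+ 'C(k.+1, j) =
  \sum_(j < k.+1) f j *+ 'C(k, j) + \sum_(j < k.+1) f j.+1 *+ 'C(k, j).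
Proof.
rewrite big_ord_recl /= bin0.
under eq_bigr => i _ do rewrite /bump /= add1n binS mulrnDr.
rewrite big_split /= addrA; congr (_ + _).
by rewrite big_ord_recr /= bin_small // mulr0n addr0 [RHS]big_ord_recl /= bin0.
Qed.

Lemma ffact_add (n a b : nat) : (n ^_ (a + b) = n ^_ a * (n - a) ^_ b)%N.
Proof.
rewrite !ffact_prod big_split_ord; congr (_ * _)%N.
by apply: eq_bigr => i _; rewrite subnDA.
Qed.

(** The coefficient of [U n r.+1 k] in [U n r k.+1], sign included. *)
Definition jump (n r : nat) : int :=
  - (2 * (n%:Z - 2 * r%:Z - (delta (n - 1)%N)%:Z)).

Definition jumps (n r j : nat) : int := \prod_(i < j) jump n (r + i).

Definition rising (x : int) (t : nat) : int := \prod_(i < t) (x + i%:Z).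

Lemma jumpsS n r j : jumps n r j.+1 = jump n r * jumps n r.+1 j.
Proof.
rewrite /jumps big_ord_recl addn0; congr (_ * _).
by apply: eq_bigr => i _; rewrite /bump addnA addn1.
Qed.

Lemma risingS x t : rising x t.+1 = x * rising (x + 1) t.
Proof.
rewrite /rising big_ord_recl addr0; congr (_ * _).
by apply: eq_bigr => i _; rewrite /bump PoszD addrA.
Qed.

(** The induction step splits on the first step of the path: a stay peels off
the smallest factor of [rising], a jump peels off the first factor of [jumps],
and Pascal's rule adds the two contributions. *)
Lemma U_sum_paths (n r k : nat) :
  U n r k =
  \sum_(j < k.+1) (jumps n r j * rising (n%:Z - r%:Z - k%:Z) (k - j)) *+ 'C(k, j).
Proof.
elim: k r => [|k IHk] r.
  by rewrite big_ord1 /jumps /rising !big_ord0.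
rewrite (sum_bin_pascal (fun j => jumps n r j *
     rising (n%:Z - r%:Z - k.+1%:Z) (k.+1 - j))).
rewrite [LHS]/= !IHk -mulNr !mulr_sumr.
congr (_ + _); apply: eq_bigr => j _; rewrite mulrnAr; congr (_ *+ _).
  have le_jk : (j <= k)%N by rewrite -ltnS.
  rewrite (subSn le_jk) risingS mulrCA.
  by have -> : n%:Z - r%:Z - k.+1%:Z + 1 = n%:Z - r%:Z - k%:Z by lia.
rewrite subSS jumpsS mulrA.
by have -> : n%:Z - r%:Z - k.+1%:Z = n%:Z - r.+1%:Z - k%:Z by lia.
Qed.

Lemma rising_ffact (a b : nat) :
  (b <= a)%N -> rising (a%:Z - b%:Z + 1) b = (a ^_ b)%:Z.
Proof.
elim: b => [|b IHb] lt_ba; first by rewrite /rising big_ord0.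
rewrite ffactnSr mulnC PoszM -IHb ?(ltnW lt_ba) // risingS.
by congr (_ * rising _ _); lia.
Qed.

(** When n = 2m the jump weights at 0, 1, ... are -2 times 2m-1, 2m-3, ...; when
n = 2m+1 they are -2 times 2m+1, 2m-1, ... . In both cases, one such odd number
and the even number 2 (m - i) are the two consecutive integers n - 2i and
n - 2i - 1. *)
Lemma ffact_double (n j : nat) : (j <= n./2)%N ->
  (n ^_ j.*2)%:Z = (n./2 ^_ j)%:Z * ((-1) ^+ j * jumps n 0 j).
Proof.
elim: j => [|j IHj] lt_jm; first by rewrite /jumps big_ord0 !ffactn0.
rewrite doubleS !ffactnSr !PoszM IHj ?(ltnW lt_jm) // /jumps big_ord_recr exprS /=.
suff -> : jump n (0 + j) = - (2 * ((n - j.*2 - ~~ odd n)%N%:Z)).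
  have def2 : (n - j.*2)%N%:Z * (n - j.*2.+1)%N%:Z =
              (n./2 - j)%N%:Z * (2 * (n - j.*2 - ~~ odd n)%N%:Z).
    have := odd_double_half n; case: (odd n) => /= def_n; nia.
  by rewrite -mulrA def2; ring.
rewrite /jump /delta modn2 add0n.
have := odd_double_half n; case def_odd: (odd n) => /= def_n.
  have -> : odd (n - 1) = false by lia.
  lia.
have -> : odd (n - 1) = true by lia.
lia.
Qed.

(** The integer n/(n-j) 'C(n-j, j), written without division. The lower index
of the second binomial is j - 1, which would be wrongly truncated at j = 0. *)
Definition lucas_coef (n j : nat) : nat :=
  'C(n - j, j) + (if j is i.+1 then 'C(n - 2 - i, i) else 0).

(** This is what makes [lucas_coef] appear: for j > 0, j! n/(n-j) 'C(n-j, j)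
equals n (n-j-1) ^_ (j-1), and the missing factors n - 1, ..., n - j of
n ^_ (2 j) are those of (n-1) ^_ j. *)
Lemma lucas_coef_ffact (n j : nat) : (0 < n)%N -> (j <= n./2)%N ->
  (lucas_coef n j * j`! * n.-1 ^_ j = n ^_ j.*2)%N.
Proof.
case: n => // n _; case: j => [|i] le_jm; first by rewrite /lucas_coef subn0 bin0.
set d := (n - i.+1)%N.
have le_in : (i.*2.+1 <= n)%N by have := odd_double_half n.+1; lia.
have lucas : (lucas_coef n.+1 i.+1 * i.+1`! = n.+1 * d ^_ i)%N.
  rewrite /lucas_coef mulnDl bin_ffact factS mulnCA.
  have -> : (n.+1 - 2 - i = d)%N by lia.
  have -> : (n.+1 - i.+1 = d.+1)%N by lia.
  by rewrite bin_ffact ffactSS -mulnDl; congr (_ * _)%N; lia.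
rewrite lucas doubleS ffactSS succnK -mulnA; congr (_ * _)%N.
have -> : (i.*2.+1 = i.+1 + i)%N by lia.
by rewrite ffact_add mulnC.
Qed.

Definition alt_bin_sum (n : nat) : int :=
  \sum_(j < n.+1) (-1) ^+ j * 'C(n - j, j)%:Z.

(** For j > n/2 the binomial vanishes, even where n - j is truncated to 0. This
frees the upper summation bound, so that sums for different n can be aligned. *)
Lemma alt_bin_sum_widen (n N : nat) : (n./2 < N)%N ->
  \sum_(j < N) (-1) ^+ j * 'C(n - j, j)%:Z = alt_bin_sum n.
Proof.
have trunc M : (n./2 < M)%N -> \sum_(j < M) (-1) ^+ j * 'C(n - j, j)%:Z =
    \sum_(j < n./2.+1) (-1) ^+ j * 'C(n - j, j)%:Z :> int.
  move=> lt_nM; rewrite -(subnKC lt_nM) big_split_ord /= [X in _ + X]big1 ?addr0 //.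
  by move=> i _; rewrite bin_small ?mulr0 //; lia.
by move=> lt_nN; rewrite /alt_bin_sum trunc // [RHS]trunc //; lia.
Qed.

(** Pascal's rule on 'C(n + 1 - i, i + 1), the term of index i + 1 of the
left-hand side. *)
Lemma alt_bin_sumSS n :
  alt_bin_sum n.+2 = alt_bin_sum n.+1 - alt_bin_sum n.
Proof.
(* Dropping the null last term leaves as many terms as in the sum for n + 1. *)
rewrite -(@alt_bin_sum_widen n.+2 n.+2); last by lia.
rewrite /alt_bin_sum big_ord_recl [in X in X - _]big_ord_recl /= !bin0 -addrA.
congr (_ + _); rewrite -sumrB; apply: eq_bigr => i _.
rewrite /bump /= add1n; have le_in : (i <= n)%N by rewrite -ltnS.
have -> : (n.+2 - i.+1 = (n - i).+1)%N by lia.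
rewrite binS subSS PoszD exprS; ring.
Qed.

Lemma alt_bin_sum_add3 n : alt_bin_sum n.+3 = - alt_bin_sum n.
Proof. by rewrite alt_bin_sumSS alt_bin_sumSS addrAC subrr add0r. Qed.

Lemma alt_bin_sum_mod6 n : alt_bin_sum n = alt_bin_sum (n %% 6).
Proof.
rewrite {1}(divn_eq n 6) addnC; elim: (n %/ 6)%N => [|a IHa].
  by rewrite mul0n addn0.
have -> : (n %% 6 + a.+1 * 6 = (n %% 6 + a * 6).+3.+3)%N by lia.
by rewrite !alt_bin_sum_add3 opprK.
Qed.

(** The stays contribute (n-1-j) ^_ (m-j) with m = n./2, the tail of (n-1) ^_ m;
the jumps and 'C(m, j) must then give the head (n-1) ^_ j times the j-th signed
Lucas coefficient, which is checked after multiplication by j!. *)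
Lemma U_diag (n : nat) : (0 < n)%N ->
  U n 0 n./2 =
  (\sum_(j < n./2.+1) (-1) ^+ j * (lucas_coef n j)%:Z) * (n.-1 ^_ n./2)%:Z.
Proof.
move=> n_gt0; rewrite U_sum_paths mulr_suml; apply: eq_bigr => j _.
have le_jm : (j <= n./2)%N by rewrite -ltnS.
have le_mn : (n./2 <= n.-1)%N by lia.
have -> : n%:Z - 0%:Z - (n./2)%:Z = (n.-1 - j)%N%:Z - (n./2 - j)%N%:Z + 1 by lia.
rewrite rising_ffact; last by lia.
have -> : (n.-1 ^_ n./2 = n.-1 ^_ j * (n.-1 - j) ^_ (n./2 - j))%N.
  by rewrite -ffact_add subnKC.
rewrite PoszM [RHS]mulrA -mulrnAl.
congr (_ * _).
have fact_neq0 : j`!%:Z != 0 by have := fact_gt0 j; lia.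
apply: (mulIf fact_neq0).
have lucas : (lucas_coef n j)%:Z * j`!%:Z * (n.-1 ^_ j)%:Z = (n ^_ j.*2)%:Z.
  by rewrite -!PoszM lucas_coef_ffact.
transitivity ((-1) ^+ j * (n ^_ j.*2)%:Z); last by rewrite -lucas; ring.
rewrite ffact_double // -bin_ffact PoszM -mulr_natr natz.
transitivity (((-1) ^+ j * (-1) ^+ j) * (jumps n 0 j * 'C(n./2, j)%:Z * j`!%:Z));
  last by ring.
by rewrite -exprD addnn -signr_odd odd_double expr0 mul1r.
Qed.

Lemma lucas_sum (n : nat) :
  \sum_(j < n.+2./2.+1) (-1) ^+ j * (lucas_coef n.+2 j)%:Z =
  alt_bin_sum n.+2 - alt_bin_sum n.
Proof.
rewrite -(@alt_bin_sum_widen n.+2 n.+2./2.+1) // -(@alt_bin_sum_widen n n.+2./2) //.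
under eq_bigr => j _ do rewrite PoszD mulrDr.
rewrite big_split /=; congr (_ + _).
rewrite big_ord_recl mulr0 add0r -sumrN; apply: eq_bigr => i _.
by rewrite lift0 exprS mulN1r mulNr !subSS subn0.
Qed.

Lemma alt_bin_sum_small :
  [/\ alt_bin_sum 0 = 1, alt_bin_sum 1 = 1 & alt_bin_sum 2 = 0].
Proof.
have F0 : alt_bin_sum 0 = 1 by rewrite /alt_bin_sum big_ord1.
have F1 : alt_bin_sum 1 = 1 by rewrite /alt_bin_sum big_ord_recl big_ord1.
by rewrite alt_bin_sumSS F0 F1.
Qed.

Lemma natr_ffact_pred (n m : nat) : (m < n)%N ->
  \prod_(1 <= j < m.+1) (n%:R - j%:R) = (n.-1 ^_ m)%:R :> rat.
Proof.
move=> lt_mn; rewrite big_add1 big_mkord ffact_prod natr_prod.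
apply: eq_bigr => i _; have lt_in := ltn_trans (ltn_ord i) lt_mn.
by rewrite -natrB // -(subn1 n) -subnDA add1n.
Qed.

Theorem theorem3 (n : nat) (hn : (0 < n)%N) :
  let q : rat :=
    (U n 0 (n %/ 2)%N)%:~R
      / \prod_(1 <= j < (n %/ 2).+1) (n%:R - j%:R) in
  [/\ (n%:Z = 0 %[mod 6])%Z -> q = 2,
      (n%:Z = 1 %[mod 6])%Z \/ (n%:Z = -1 %[mod 6])%Z -> q = 1,
      (n%:Z = 2 %[mod 6])%Z \/ (n%:Z = -2 %[mod 6])%Z -> q = -1
    & (n%:Z = 3 %[mod 6])%Z \/ (n%:Z = -3 %[mod 6])%Z -> q = -2].
Proof.
rewrite divn2 natr_ffact_pred; last by lia.
rewrite U_diag // intrM -pmulrn mulfK; last first.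
  by rewrite pnatr_eq0 -lt0n ffact_gt0; lia.
case: n hn => [|[|n]] // _.
  by rewrite big_ord1 /=; split=> [mod6|//|[] mod6|[] mod6].
rewrite lucas_sum alt_bin_sumSS alt_bin_sum_mod6 (alt_bin_sum_mod6 n).
have [F0 F1 F2] := alt_bin_sum_small.
have : (n %% 6 < 6)%N by rewrite ltn_mod.
rewrite -(addn1 n) -modnDml.
case def_r: (n %% 6)%N => [|[|[|[|[|[|r]]]]]] // _;
  rewrite /= ?alt_bin_sum_add3 ?F0 ?F1 ?F2.
all: split=> mod6.
all: by [|lia].
Qed.
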